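(* Let $n\geq 4$ be an integer and let $\mathbb{F}$ be a field of characteristic different from $2$. Then the number $N_n(\mathbb{F})$ of $\sim$-equivalence classes in $\mathcal{TM}_n$ is finite if and only if $\mathbb{F}$ is a finite field.
   Context: Let $\mathbb{F}$ be a field of characteristic different from $2$. For $n\geq 2$, $\mathcal{TM}_n$ denotes the set of all strictly lower triangular $n\times n$ matrices with entries in $\mathbb{F}$. For $T=[t_{ij}]\in\mathcal{TM}_n$, $\mathcal{A}(T)$ is the commutative (unital, associative) $\mathbb{F}$-algebra given by generators $X_1,\dots,X_n$ and relations $X_1^2=0$ and $X_i^2=\sum_{j<i}t_{ij}X_jX_i$ for $2\leq i\leq n$; it is graded by $\deg(X_i)=2$. For $T,S\in\mathcal{TM}_n$ write $T\sim S$ if there is a degree preserving isomorphism of graded $\mathbb{F}$-algebras $\mathcal{A}(T)\to\mathcal{A}(S)$; this is an equivalence relation, and $N_n(\mathbb{F})$ is the number of its equivalence classes in $\mathcal{TM}_n$. *)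

(* Defs.v *)
From HB Require Import structures.
From mathcomp Require Import all_boot all_order all_algebra.
From mathcomp Require Import generic_quotient ring_quotient.
From mathcomp Require Import boolp classical_sets cardinality.
From mathcomp Require Import mpoly.

Set Implicit Arguments.
Unset Strict Implicit.
Unset Printing Implicit Defensive.

Import GRing.Theory.
Local Open Scope ring_scope.
Local Open Scope quotient_scope.

Definition TM (F : fieldType) (n : nat) : set 'M[F]_n :=
  [set T | forall i j : 'I_n, (i <= j)%N -> T i j = 0].

Section Algebra.
Context (F : fieldType) (n : nat) (T : 'M[F]_n).

(* For the least index the sum is empty, so that the relation is X_1^2 = 0. *)
Definition relator (i : 'I_n) : {mpoly F[n]} :=
  'X_i ^+ 2 - \sum_(j < n | (j < i)%N) T i j *: ('X_j * 'X_i).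

Definition relIdeal (p : {mpoly F[n]}) : bool :=
  `[< exists q : 'I_n -> {mpoly F[n]}, p = \sum_i q i * relator i >].

(* The relators vanish at the origin, so the ideal is proper, as the quotient
   construction requires. *)
Lemma relIdeal_closed : idealr_closed relIdeal.
Proof.
split.
- by apply/asboolP; exists (fun=> 0); rewrite big1 // => i _; rewrite mul0r.
- apply/negP => /asboolP [q] /(congr1 (meval (fun=> 0 : F))) /eqP.
  rewrite rmorph1 rmorph_sum big1 /= ?oner_eq0 // => i _.
  rewrite mevalM mevalB rmorphXn /= mevalXU expr0n rmorph_sum big1 ?subr0 ?mulr0 //.
  by move=> j _; rewrite /= mevalZ mevalM !mevalXU !mulr0.
- move=> a u v /asboolP [q ->] /asboolP [r ->]; apply/asboolP.
  exists (fun i => a * q i + r i); rewrite mulr_sumr -big_split /=.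
  by apply: eq_bigr => i _; rewrite mulrDl mulrA.
Qed.

HB.instance Definition _ := isIdealr.Build {mpoly F[n]} relIdeal relIdeal_closed.

Definition idealT : idealr {mpoly F[n]} := relIdeal.

Definition algA := {ideal_quot idealT}.

HB.instance Definition _ := GRing.ComNzRing.on algA.

Definition projA (p : {mpoly F[n]}) : algA := \pi_{ideal_quot idealT} p.

Lemma projA_zmod : zmod_morphism projA.
Proof. exact: rmorphB. Qed.

Lemma projA_monoid : monoid_morphism projA.
Proof. by split; [exact: rmorph1 | exact: rmorphM]. Qed.

HB.instance Definition _ :=
  GRing.isZmodMorphism.Build {mpoly F[n]} algA projA projA_zmod.
HB.instance Definition _ :=
  GRing.isMonoidMorphism.Build {mpoly F[n]} algA projA projA_monoid.

Definition scaleA (c : F) (a : algA) : algA := projA c%:MP * a.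

Lemma scaleA_assoc c d a : scaleA c (scaleA d a) = scaleA (c * d) a.
Proof. by rewrite /scaleA mulrA -rmorphM -mpolyCM. Qed.

Lemma scaleA_1 : left_id 1 scaleA.
Proof. by move=> a; rewrite /scaleA mpolyC1 rmorph1 mul1r. Qed.

Lemma scaleA_Dr : right_distributive scaleA +%R.
Proof. by move=> c a b; rewrite /scaleA mulrDr. Qed.

Lemma scaleA_Dl a : {morph scaleA^~ a : c d / c + d}.
Proof. by move=> c d; rewrite /scaleA mpolyCD rmorphD mulrDl. Qed.

HB.instance Definition _ := GRing.Zmodule_isLmodule.Build F algA
  scaleA_assoc scaleA_1 scaleA_Dr scaleA_Dl.

Lemma scaleA_Al c (a b : algA) : c *: (a * b) = (c *: a) * b.
Proof. by rewrite /GRing.scale /= /scaleA mulrA. Qed.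

HB.instance Definition _ := GRing.Lmodule_isLalgebra.Build F algA scaleA_Al.
HB.instance Definition _ := GRing.Lalgebra_isComAlgebra.Build F algA.

(* The component of degree d, each X_i having degree 2; it is 0 for d odd. *)
Definition graded (d : nat) : set algA :=
  projA @` [set p | {in msupp p, forall m, (2 * mdeg m)%N = d}]%classic.

End Algebra.

Definition graded_iso (F : fieldType) (n : nat) (T S : 'M[F]_n) : Prop :=
  exists f : {lrmorphism algA T -> algA S}, bijective f /\
    forall d a, graded d a <-> graded d (f a).

Section Equivalence.
Context (F : fieldType) (n : nat).
Implicit Types T S U : 'M[F]_n.

Lemma graded_iso_refl T : graded_iso T T.
Proof. exists idfun; split; first by exists idfun. by []. Qed.

Lemma graded_iso_sym T S : graded_iso T S -> graded_iso S T.
Proof.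
case=> f [[g fK gK] h].
have g1 : zmod_morphism g by exact: can2_zmod_morphism fK gK.
have g2 : monoid_morphism g by exact: can2_monoid_morphism fK gK.
have g3 : scalable g by exact: can2_scalable fK gK.
pose G1 := GRing.isZmodMorphism.Build _ _ g g1.
pose G2 := GRing.isMonoidMorphism.Build _ _ g g2.
pose G3 := GRing.isScalable.Build _ _ _ _ g g3.
pose G : {lrmorphism algA S -> algA T} := HB.pack g G1 G2 G3.
exists G; split; first by exists f.
by move=> d a; rewrite (h d (G a)) /= gK.
Qed.

Lemma graded_iso_trans T S U : graded_iso T S -> graded_iso S U -> graded_iso T U.
Proof.
case=> f [bf hf] [g [bg hg]]; exists (g \o f); split; first exact: bij_comp.
by move=> d a; rewrite hf hg.
Qed.

End Equivalence.

(* N_n(F) is the cardinality of this set. *)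
Definition iso_classes (F : fieldType) (n : nat) : set (set 'M[F]_n) :=
  [set C | exists2 T, TM T & C = [set S | TM S /\ graded_iso T S]]%classic.

Arguments iso_classes F n : clear implicits.

(* Main.v *)
Require Import Defs.
From mathcomp Require Import all_boot all_order all_algebra.
From mathcomp Require Import boolp classical_sets cardinality.
From mathcomp Require Import mpoly ring zify.

Set Implicit Arguments.
Unset Strict Implicit.
Unset Printing Implicit Defensive.

Import GRing.Theory.
Local Open Scope ring_scope.

(** Completing squares, the algebra of the t-th member of the family below has a
    basis x, y, z, w, v_5, ..., v_n in degree 2 such that x, y and all v_i square
    to 0, z^2 = 2xy and w^2 = 2(t + 1)xy + 2t xz + 2yz, the squarefree products
    of basis elements being linearly independent. The elements of square zero are
    the multiples of x, y and the v_i, so a graded isomorphism between two members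
    preserves, up to scalars, first {x, y}, then z, then w; comparing coefficients,
    t / (t + 1)^2 is an invariant up to denominators. Its fibres are {t, 1/t}, so
    an infinite field yields infinitely many classes. Over a finite field there are
    only finitely many matrices. *)

(** * Linear forms and Taylor coefficients at the origin *)

Section LinearForms.
Context (F : fieldType) (n : nat).
Implicit Types (a b : 'rV[F]_n) (p q : {mpoly F[n]}) (i j k : 'I_n).

Definition linform a : {mpoly F[n]} := \sum_i a 0 i *: 'X_i.

Lemma linformD a b : linform (a + b) = linform a + linform b.
Proof.
by rewrite -big_split; apply: eq_bigr => i _; rewrite mxE scalerDl.
Qed.

Lemma linformZ c a : linform (c *: a) = c *: linform a.
Proof.
by rewrite scaler_sumr; apply: eq_bigr => i _; rewrite mxE scalerA.
Qed.

Lemma linformB a b : linform (a - b) = linform a - linform b.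
Proof. by rewrite linformD -scaleN1r linformZ scaleN1r. Qed.

Lemma linform_delta i : linform (delta_mx 0 i) = 'X_i.
Proof.
rewrite /linform (bigD1 i) //= mxE !eqxx scale1r big1 ?addr0 // => j /negPf ji.
by rewrite mxE ji andbF scale0r.
Qed.

(** Taking derivatives at the origin lets products follow the Leibniz rule. [coef2 j k] is the
    coefficient of X_j X_k if j <> k, and twice that of X_j^2 if j = k. *)
Definition coef0 p : F := p.@[fun=> 0].
Definition coef1 i p : F := coef0 p^`M(i).
Definition coef2 j k p : F := coef0 (p^`M(j))^`M(k).

Lemma coef0M p q : coef0 (p * q) = coef0 p * coef0 q.
Proof. exact: mevalM. Qed.

Lemma coef1M i p q : coef1 i (p * q) = coef1 i p * coef0 q + coef0 p * coef1 i q.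
Proof. by rewrite /coef1 mderivM /coef0 mevalD !mevalM. Qed.

Lemma coef2M j k p q :
  coef2 j k (p * q) = coef2 j k p * coef0 q + coef1 j p * coef1 k q
    + (coef1 k p * coef1 j q + coef0 p * coef2 j k q).
Proof.
by rewrite /coef2 mderivM mderivD !mderivM /coef1 /coef0 !mevalD !mevalM.
Qed.

Lemma deriv_linform i a : (linform a)^`M(i) = (a 0 i)%:MP.
Proof.
rewrite /linform raddf_sum (bigD1 i) //= big1 ?addr0.
  rewrite mderivZ mderivX mnm1E eqxx scale1r -mul_mpolyC.
  by rewrite (_ : (U_(i) - U_(i) = 0)%MM) ?mpolyX0 ?mulr1 //;
     apply/mnmP => l; rewrite mnmBE subnn mnm0E.
by move=> j /negPf ji; rewrite mderivZ mderivX mnm1E ji scale0r scaler0.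
Qed.

Lemma coef0_linform a : coef0 (linform a) = 0.
Proof.
rewrite /coef0 raddf_sum big1 // => i _.
by rewrite [LHS]mevalZ mevalXU mulr0.
Qed.

Lemma coef1_linform i a : coef1 i (linform a) = a 0 i.
Proof. by rewrite /coef1 deriv_linform /coef0 mevalC. Qed.

Lemma coef2_linformM j k a b :
  coef2 j k (linform a * linform b) = a 0 j * b 0 k + a 0 k * b 0 j.
Proof.
by rewrite coef2M !coef0_linform !coef1_linform !mul0r mulr0 addr0 add0r.
Qed.

Lemma coef2_mul_linformM j k q a b :
  coef2 j k (q * (linform a * linform b)) =
  coef0 q * (a 0 j * b 0 k + a 0 k * b 0 j).
Proof.
rewrite coef2M coef2_linformM coef0M !coef1M !coef0_linform.
by rewrite !(mul0r, mulr0, addr0, add0r).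
Qed.

End LinearForms.

(** * Coordinates on the components of degree 2 and 4 of the algebra *)

Section Coordinates.
Context (F : fieldType) (n : nat) (T : 'M[F]_n).
Implicit Types (a b : 'rV[F]_n) (p q : {mpoly F[n]}) (i j k : 'I_n).

Lemma projA_eq p q : projA T p = projA T q -> relIdeal T (p - q).
Proof.
by move=> e; change (p - q \in idealT T); rewrite Quotient.idealrBE; apply/eqP.
Qed.

Lemma projA_ideal p : relIdeal T p -> projA T p = 0.
Proof.
move=> pI; rewrite -[RHS](raddf0 (projA T)); apply/eqP.
by rewrite -(Quotient.idealrBE (idealT T)) subr0.
Qed.

Lemma projAD p q : projA T (p + q) = projA T p + projA T q.
Proof. exact: rmorphD. Qed.

Lemma projAZ c p : projA T (c *: p) = c *: projA T p.
Proof. by rewrite -mul_mpolyC rmorphM. Qed.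

Lemma projA_scale c (u : algA T) : c *: u = projA T c%:MP * u.
Proof. by []. Qed.

Lemma projA_nat (m : nat) : projA T m%:R%:MP = m%:R.
Proof. by rewrite !rmorph_nat. Qed.

(** With both factors linear, [coef2_mul_linformM] applies to every multiple of a relator. *)
Lemma relator_linform i : relator T i = linform (delta_mx 0 i) *
  linform (delta_mx 0 i - \row_j (if (j < i)%N then T i j else 0)).
Proof.
rewrite linformB linform_delta /relator mulrBr -expr2; congr (_ - _).
rewrite /linform big_mkcond mulr_sumr; apply: eq_bigr => j _.
by rewrite mxE; case: ifP => _; rewrite ?scale0r ?mulr0 // scalerAl mulrC.
Qed.

(** The relators lie in the square of the ideal of polynomials vanishing at 0, so no relation has a
    linear part. *)
Lemma coef1_ideal i p : relIdeal T p -> coef1 i p = 0.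
Proof.
move=> /asboolP [q ->]; rewrite /coef1 raddf_sum /coef0 raddf_sum big1 //= => l _.
rewrite -/(coef0 _) -/(coef1 i _) relator_linform !coef1M.
by rewrite coef0M !coef0_linform !(mul0r, mulr0, addr0).
Qed.

Lemma projA_linform_inj : injective (fun a => projA T (linform a)).
Proof.
move=> a b /= /projA_eq; rewrite -linformB => abI; apply/rowP => i.
have := coef1_ideal i abI; rewrite coef1_linform !mxE => /eqP.
by rewrite subr_eq0 => /eqP.
Qed.

(* Twice the coordinate along X_j X_k, for j < k, with respect to the basis of
   squarefree monomials: X_k^2 contributes through X_k^2 = ... + T k j X_j X_k. *)
Definition coord j k p : F := 2 * coef2 j k p + T k j * coef2 k k p.

Lemma coordD j k p q : coord j k (p + q) = coord j k p + coord j k q.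
Proof. by rewrite /coord /coef2 !mderivD /coef0 !mevalD; ring. Qed.

Lemma coordZ j k c p : coord j k (c *: p) = c * coord j k p.
Proof. by rewrite /coord /coef2 !mderivZ /coef0 !mevalZ; ring. Qed.

Lemma coord_ideal j k p : (j < k)%N -> relIdeal T p -> coord j k p = 0.
Proof.
move=> jk /asboolP [q ->].
elim/big_rec: _ => [|i r _ IH].
  by rewrite -(scale0r 0) coordZ mul0r.
rewrite coordD IH addr0 /coord relator_linform !coef2_mul_linformM !mxE eqxx /=.
(* For i = k the term of X_k^2 cancels that of - T k j X_j X_k. For i = j only variables up to X_j
   occur, and j < k. Any other relator is divisible by an X_i with i distinct from j and k. *)
have [ki | ki] := eqVneq k i.
  have /negPf ji : j != i by rewrite -ki neq_ltn jk.
  rewrite ji -ki ltnn jk /=; ring.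
have [ji | ji] := eqVneq j i; last by rewrite /=; ring.
by rewrite -ji ltnNge (ltnW jk) /=; ring.
Qed.

Lemma coord_linformM j k a b : coord j k (linform a * linform b) =
  2 * (a 0 j * b 0 k + a 0 k * b 0 j + a 0 k * b 0 k * T k j).
Proof. by rewrite /coord !coef2_linformM; ring. Qed.

Lemma coord_projA j k p q : (j < k)%N -> projA T p = projA T q ->
  coord j k p = coord j k q.
Proof.
move=> jk /projA_eq /(coord_ideal jk) /eqP.
by rewrite coordD -scaleN1r coordZ mulN1r subr_eq0 => /eqP.
Qed.

Lemma graded_linform a : graded 2 (projA T (linform a)).
Proof.
exists (linform a) => // m; rewrite mcoeff_msupp /linform raddf_sum /=.
apply: contraNeq => m1; rewrite big1 // => i _.
rewrite mcoeffZ mcoeffX; case: eqP => [im | _]; rewrite ?mulr0 //.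
by case/eqP: m1; rewrite -im mdeg1.
Qed.

Lemma gradedP u : graded 2 u -> exists a, u = projA T (linform a).
Proof.
case=> p /= pd <-; exists (\row_i p@_U_(i)); congr projA; apply/mpolyP => m.
rewrite /linform raddf_sum /=.
have [/mdeg1P[i /eqP ->] | m1] := boolP (mdeg m == 1%N).
  rewrite (bigD1 i) //= mcoeffZ mcoeffX eqxx mxE mulr1 big1 ?addr0 // => j ji.
  rewrite mcoeffZ mcoeffX; case: eqP => [/mnmP /(_ j) | _]; rewrite ?mulr0 //.
  by rewrite !mnm1E eqxx eq_sym (negPf ji).
rewrite big1 => [|i _].
  apply: memN_msupp_eq0; apply: contra m1 => /pd /eqP.
  by rewrite -[2%N in X in _ == X]muln1 eqn_pmul2l.
rewrite mcoeffZ mcoeffX; case: eqP => [im | _]; rewrite ?mulr0 //.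
by move: m1; rewrite -im mdeg1.
Qed.

Lemma projA_sqr i : projA T 'X_i ^+ 2 =
  \sum_(j < n | (j < i)%N) T i j *: (projA T 'X_j * projA T 'X_i).
Proof.
have : projA T (relator T i) = 0.
  apply: projA_ideal; apply/asboolP; exists (fun j => (j == i)%:R).
  rewrite (bigD1 i) //= eqxx mul1r big1 ?addr0 // => j /negPf ->.
  by rewrite mul0r.
rewrite /relator rmorphB rmorphXn raddf_sum /= => /eqP; rewrite subr_eq0 => /eqP ->.
by apply: eq_bigr => j _; rewrite projAZ rmorphM.
Qed.

End Coordinates.

(** * The one-parameter family and its rigidity *)

Section Family.
Context (F : fieldType) (n : nat) (n_ge4 : (4 <= n)%N) (two_neq0 : 2 != 0 :> F).
Implicit Types (t : F) (a b c d : 'rV[F]_n) (i j k : 'I_n).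

Let o0 : 'I_n := Ordinal (leq_trans (isT : (0 < 4)%N) n_ge4).
Let o1 : 'I_n := Ordinal (leq_trans (isT : (1 < 4)%N) n_ge4).
Let o2 : 'I_n := Ordinal (leq_trans (isT : (2 < 4)%N) n_ge4).
Let o3 : 'I_n := Ordinal (leq_trans (isT : (3 < 4)%N) n_ge4).

(** Numbering variables from 0, the even entries complete squares without division: x = X_0, y =
    X_1, z = X_2 - X_0 - X_1 and w = X_3 - (t - 1) X_0 - X_2. *)
Definition family t : 'M[F]_n := \matrix_(i, j)
  match nat_of_ord i, nat_of_ord j with
  | 2, 0 | 2, 1 | 3, 2 => 2
  | 3, 0 => 2 * (t - 1)
  | _, _ => 0
  end.

Lemma family_TM t : TM (family t).
Proof.
by move=> [[|[|[|[|i]]]] ?] [[|[|[|j]]] ?] /=; rewrite mxE.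
Qed.

Lemma ordP k : [\/ k = o0, k = o1, k = o2 | k = o3] \/ (4 <= k)%N.
Proof.
case: k => [[|[|[|[|k]]]] ltk]; last (by right); left;
  [constructor 1 | constructor 2 | constructor 3 | constructor 4]; exact: val_inj.
Qed.

Lemma family_eq0 t j k : k != o2 -> k != o3 -> family t k j = 0.
Proof.
by rewrite -!val_eqE mxE; case: k => [[|[|[|[|k]]]] ltk].
Qed.

Lemma mulf2_eq0 (x : F) : (2 * x == 0) = (x == 0).
Proof. by rewrite mulf_eq0 (negPf two_neq0). Qed.

Section Square.
Context (t : F) (a : 'rV[F]_n).

(* The coordinate along X_j X_k, for j < k, of the square of the linear form a. *)
Let sq j k : F := a 0 k * (2 * a 0 j + a 0 k * family t k j).

(** If a_3 <> 0, the first two equations give a_1 = 0 and a_2 = - a_3, and then the third coordinate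
    is 2 a_3^2. Only three coordinates are assumed to vanish, so that the image of z is covered
    too. *)
Lemma sq_o3_eq0 : sq o1 o3 = 0 -> sq o2 o3 = 0 -> sq o1 o2 = 0 -> a 0 o3 = 0.
Proof.
rewrite /sq !mxE /= => e13 e23 e12; apply/eqP/negP => /negP a3.
have a1 : a 0 o1 = 0.
  by move/eqP: e13; rewrite mulr0 addr0 mulf_eq0 (negPf a3) mulf2_eq0 => /eqP.
have a2 : a 0 o2 = - a 0 o3.
  move/eqP: e23; rewrite mulf_eq0 (negPf a3) mulrC -mulrDl mulrC mulf2_eq0.
  by rewrite addr_eq0 => /eqP.
move/eqP: e12; rewrite a1 a2 mulr0 add0r !mulf_eq0 oppr_eq0 (negPf a3).
by rewrite (negPf two_neq0).
Qed.

(** On X_0, X_1, X_2 this is the shape of a multiple of z. *)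
Lemma sq_o2 : sq o0 o2 = 0 -> sq o1 o2 = 0 -> a 0 o2 != 0 ->
  a 0 o0 = - a 0 o2 /\ a 0 o1 = - a 0 o2.
Proof.
rewrite /sq !mxE /= => e02 e12 a2; split; apply/eqP; rewrite -addr_eq0.
  move/eqP: e02; rewrite mulf_eq0 (negPf a2) [a 0 o2 * 2]mulrC -mulrDr.
  by rewrite mulf2_eq0.
move/eqP: e12; rewrite mulf_eq0 (negPf a2) [a 0 o2 * 2]mulrC -mulrDr.
by rewrite mulf2_eq0.
Qed.

Lemma sq_squarefree j k : a 0 o2 = 0 -> a 0 o3 = 0 ->
  sq j k = 2 * (a 0 j * a 0 k).
Proof.
move=> a2 a3; rewrite /sq.
have [-> | k2] := eqVneq k o2; first by rewrite a2; ring.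
have [-> | k3] := eqVneq k o3; first by rewrite a3; ring.
by rewrite family_eq0 //; ring.
Qed.

Lemma sq_top j k : (4 <= k)%N -> sq j k = 2 * (a 0 j * a 0 k).
Proof. by move=> k4; rewrite /sq family_eq0 -?val_eqE /=; [ring | lia..]. Qed.

End Square.

(** Once a_3 and then a_2 are shown to vanish, the square has coordinates 2 a_j a_k, so only one
    entry can be nonzero. *)
Lemma square_zero t a : a != 0 ->
  (forall j k, (j < k)%N -> a 0 k * (2 * a 0 j + a 0 k * family t k j) = 0) ->
  exists i, [/\ i != o2, i != o3, a 0 i != 0 & a = a 0 i *: delta_mx 0 i].
Proof.
move=> a_neq0 sq0.
have a3 : a 0 o3 = 0 by apply: (@sq_o3_eq0 t); apply: sq0.
have a2 : a 0 o2 = 0.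
  apply/eqP/negP => /negP a2.
  have [a0 a1] := sq_o2 (sq0 o0 o2 isT) (sq0 o1 o2 isT) a2.
  move/eqP: (sq0 o0 o1 isT); rewrite a0 a1 mxE mulr0 addr0 !mulf_eq0 oppr_eq0.
  by rewrite (negPf a2) (negPf two_neq0).
have [i ai] : exists i, a 0 i != 0.
  apply/existsP; apply: contraNT a_neq0 => /existsPn a0; apply/eqP/rowP => i.
  by rewrite mxE; apply/eqP; move: (a0 i); rewrite negbK.
exists i; split=> //; try by apply: contraNneq ai => ->; rewrite ?a2 ?a3.
apply/rowP => j; rewrite !mxE eqxx /=.
have [-> | ji] := eqVneq j i; first by rewrite mulr1.
rewrite mulr0; apply/eqP; move: ji; rewrite -val_eqE neq_ltn => /orP[] /sq0 /eqP;
  by rewrite sq_squarefree // mulf2_eq0 mulf_eq0 (negPf ai) ?orbF.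
Qed.

(* B u v j k is the coordinate along X_j X_k of the product of the linear forms
   u and v in the t'-th algebra; a, b, c, d are the images there of the elements
   x, y, z, w of the t-th one. *)
Lemma family_rigid t t' a b c d :
    let B u v j k := u 0 j * v 0 k + u 0 k * v 0 j + u 0 k * v 0 k * family t' k j in
    (forall l m p q, l *: a + m *: b + p *: c + q *: d = 0 ->
       [/\ l = 0, m = 0, p = 0 & q = 0]) ->
    (forall j k, (j < k)%N ->
       [/\ B a a j k = 0, B b b j k = 0, B c c j k = 2 * B a b j k
         & B d d j k = 2 * (t + 1) * B a b j k + 2 * t * B a c j k
             + 2 * B b c j k]) ->
  t * (t' + 1) ^+ 2 = t' * (t + 1) ^+ 2.
Proof.
move=> B indep rel.
have BE u j k : B u u j k = u 0 k * (2 * u 0 j + u 0 k * family t' k j).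
  by rewrite /B; ring.
have a_neq0 : a != 0.
  apply/eqP => a0; have [] := indep 1 0 0 0; last by move/eqP; rewrite oner_eq0.
  by rewrite a0 scaler0 !scale0r !addr0.
have b_neq0 : b != 0.
  apply/eqP => b0; have [] := indep 0 1 0 0; last by move=> _ /eqP; rewrite oner_eq0.
  by rewrite b0 scaler0 !scale0r !addr0.
have [|i [i2 i3 ai aE]] := @square_zero t' a a_neq0.
  by move=> j k /rel []; rewrite BE.
have [|i' [i'2 i'3 bi bE]] := @square_zero t' b b_neq0.
  by move=> j k /rel [_]; rewrite BE.
have a0 j : j != i -> a 0 j = 0.
  by move=> /negPf ji; rewrite aE !mxE ji andbF mulr0.
have b0 j : j != i' -> b 0 j = 0.
  by move=> /negPf ji; rewrite bE !mxE ji andbF mulr0.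
have ii' : i != i'.
  (* If i = i', then b_i a - a_i b = 0 is a nontrivial relation. *)
  apply/eqP => ii'; have [] := indep (b 0 i) (- a 0 i) 0 0; last first.
    by rewrite ii' => /eqP; rewrite (negPf bi).
  apply/rowP => j; rewrite !mxE.
  have [-> | ji] := eqVneq j i; first by ring.
  by rewrite (a0 j) // (b0 j) -?ii' //; ring.
have [a2 a3 b2 b3] : [/\ a 0 o2 = 0, a 0 o3 = 0, b 0 o2 = 0 & b 0 o3 = 0].
  by split; first [apply: a0 | apply: b0]; rewrite eq_sym.
(* Only rows 2 and 3 of [family] are nonzero, so in products with a or b the squares X_k^2
   contribute nothing. *)
have aS k j : a 0 k * family t' k j = 0.
  have [-> | k2] := eqVneq k o2; first by rewrite a2 mul0r.
  have [-> | k3] := eqVneq k o3; first by rewrite a3 mul0r.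
  by rewrite family_eq0 ?mulr0.
have bS k j : b 0 k * family t' k j = 0.
  have [-> | k2] := eqVneq k o2; first by rewrite b2 mul0r.
  have [-> | k3] := eqVneq k o3; first by rewrite b3 mul0r.
  by rewrite family_eq0 ?mulr0.
have BaE v j k : B a v j k = a 0 j * v 0 k + a 0 k * v 0 j.
  by rewrite /B mulrAC aS mul0r addr0.
have BbE v j k : B b v j k = b 0 j * v 0 k + b 0 k * v 0 j.
  by rewrite /B mulrAC bS mul0r addr0.
have cE j k : (j < k)%N -> c 0 k * (2 * c 0 j + c 0 k * family t' k j) =
    2 * (a 0 j * b 0 k + a 0 k * b 0 j).
  by move=> /rel [_ _]; rewrite BE BaE.
have dE j k : (j < k)%N -> d 0 k * (2 * d 0 j + d 0 k * family t' k j) =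
    2 * ((t + 1) * (a 0 j * b 0 k + a 0 k * b 0 j)
         + t * (a 0 j * c 0 k + a 0 k * c 0 j)
         + (b 0 j * c 0 k + b 0 k * c 0 j)).
  by move=> /rel [_ _ _]; rewrite BE !BaE BbE => ->; ring.
have c3 : c 0 o3 = 0.
  by apply: (@sq_o3_eq0 t'); rewrite cE // ?a2 ?a3 ?b2 ?b3; ring.
(* Otherwise c^2 is a multiple of a b only if c is in the span of a and b. *)
have c2 : c 0 o2 != 0.
  apply/eqP => c2.
  have cc j k : j != k -> c 0 j * c 0 k = a 0 j * b 0 k + a 0 k * b 0 j.
    rewrite -val_eqE neq_ltn => /orP[] /cE; rewrite sq_squarefree //;
      move/(mulfI two_neq0); first by [].
    by rewrite mulrC addrC ![_ * b _ _]mulrC => ->; rewrite addrC; ring.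
  have ci : c 0 i * c 0 i' = a 0 i * b 0 i'.
    by rewrite cc // (a0 i') 1?eq_sym // mul0r addr0.
  have cr r : r != i -> r != i' -> c 0 r = 0.
    (* Here c_r c_i = 0, while c_i c_i' = a_i b_i' is nonzero. *)
    move=> ri ri'; have := cc r i ri; rewrite (a0 r) // (b0 r) // mul0r mulr0 addr0.
    move/eqP; rewrite mulf_eq0 => /orP[/eqP // | /eqP ci0].
    by move/eqP: ci; rewrite ci0 mul0r eq_sym mulf_eq0 (negPf ai) (negPf bi).
  have [] := indep (c 0 i / a 0 i) (c 0 i' / b 0 i') (-1) 0; last first.
    by move=> _ _ /eqP; rewrite oppr_eq0 oner_eq0.
  apply/rowP => j; rewrite !mxE.
  have [-> | ji] := eqVneq j i; first by rewrite (b0 i) //; field; rewrite ai bi.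
  have [-> | ji'] := eqVneq j i'.
    by rewrite (a0 i') 1?eq_sym //; field; rewrite ai bi.
  by rewrite (a0 j) // (b0 j) // (cr j) //; ring.
(* With [c3] and [c_top], this makes c a multiple of z in the target. *)
have [c0 c1] : c 0 o0 = - c 0 o2 /\ c 0 o1 = - c 0 o2.
  by apply: (@sq_o2 t') => //; rewrite cE // a2 b2; ring.
have c_top k : (4 <= k)%N -> c 0 k = 0.
  move=> k4; have := cE o2 k (ltn_trans _ k4); rewrite sq_top // a2 b2.
  rewrite mulr0 mul0r addr0 mulr0 => /(_ isT) /eqP.
  by rewrite mulf2_eq0 mulf_eq0 (negPf c2) => /eqP.
have c2E : c 0 o2 ^+ 2 = a 0 o0 * b 0 o1 + a 0 o1 * b 0 o0.
  apply: (mulfI two_neq0); rewrite -cE // c0 c1 mxE /=; ring.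
have c2S : c 0 o2 ^+ 2 != 0 by rewrite sqrf_eq0.
(* By [c2E] the product ab has a nonzero coordinate along X_0 X_1, so the images of x and y are
   multiples of X_0 and X_1 in some order. *)
have ab : i = o0 /\ i' = o1 \/ i = o1 /\ i' = o0.
  have [io0 | io0] := eqVneq i o0.
    left; split=> //; apply/eqP; apply: contraNT c2S => i'1.
    by rewrite c2E (b0 o1) 1?eq_sym // (a0 o1) ?io0 // !(mulr0, mul0r) addr0.
  have i'0 : i' = o0.
    apply/eqP; apply: contraNT c2S => i'0.
    by rewrite c2E (a0 o0) 1?eq_sym // (b0 o0) 1?eq_sym // !(mulr0, mul0r) addr0.
  right; split=> //; apply/eqP; apply: contraNT c2S => i1.
  by rewrite c2E (a0 o0) 1?eq_sym // (a0 o1) 1?eq_sym // !mul0r addr0.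
have e02 : d 0 o2 * (d 0 o0 + d 0 o2) = (t * a 0 o0 + b 0 o0) * c 0 o2.
  apply: (mulfI two_neq0); have := dE o0 o2 isT; rewrite a2 b2 mxE /= => e.
  by transitivity (d 0 o2 * (2 * d 0 o0 + d 0 o2 * 2)); [ring | rewrite e; ring].
have e12 : d 0 o2 * (d 0 o1 + d 0 o2) = (t * a 0 o1 + b 0 o1) * c 0 o2.
  apply: (mulfI two_neq0); have := dE o1 o2 isT; rewrite a2 b2 mxE /= => e.
  by transitivity (d 0 o2 * (2 * d 0 o1 + d 0 o2 * 2)); [ring | rewrite e; ring].
have e01 : d 0 o0 * d 0 o1 = (t + 1) * c 0 o2 ^+ 2
    - c 0 o2 * (t * (a 0 o0 + a 0 o1) + (b 0 o0 + b 0 o1)).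
  apply: (mulfI two_neq0); have := dE o0 o1 isT; rewrite -c2E c0 c1 mxE /= => e.
  by transitivity (d 0 o1 * (2 * d 0 o0 + d 0 o1 * 0)); [ring | rewrite e; ring].
have top k : (4 <= k)%N -> a 0 k = 0 /\ b 0 k = 0.
  move=> k4; have [k0 k1] : k != o0 /\ k != o1 by rewrite -!val_eqE /=; lia.
  by case: ab => -[ai_ bi_]; rewrite a0 ?b0 // ?ai_ ?bi_.
(* Otherwise d would be in the span of a, b and c. *)
have d3 : d 0 o3 != 0.
  (* If d_2 = 0, then [e02] and [e12] give t a_l + b_l = 0 for l = 0, 1; at l = i', where a
     vanishes, this contradicts b_i' <> 0. *)
  apply/eqP => d3; have [d2 | d2] := eqVneq (d 0 o2) 0.
    move/esym/eqP: e02; rewrite d2 mul0r mulf_eq0 (negPf c2) orbF.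
    move/esym/eqP: e12; rewrite d2 mul0r mulf_eq0 (negPf c2) orbF.
    case: ab => -[iE i'E].
      by rewrite (a0 o1) ?iE // mulr0 add0r -i'E (negPf bi).
    by move=> _; rewrite (a0 o0) ?iE // mulr0 add0r -i'E (negPf bi).
  have dk k : (4 <= k)%N -> d 0 k = 0.
    move=> k4; have := dE o2 k (ltn_trans _ k4); rewrite sq_top //.
    have [-> ->] := top k k4; rewrite a2 b2 c_top //.
    rewrite !(mulr0, mul0r, addr0) => /(_ isT) /eqP.
    by rewrite mulf2_eq0 mulf_eq0 (negPf d2) => /eqP.
  have [ci ci'] : c 0 i = - c 0 o2 /\ c 0 i' = - c 0 o2.
    by case: ab => -[-> ->].
  (* The coefficient of c is read off at X_2; those of a and b then follow at X_i and X_i' from c_i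
     = c_i' = - c_2. *)
  have [] := indep ((d 0 i + d 0 o2) / a 0 i) ((d 0 i' + d 0 o2) / b 0 i')
    (d 0 o2 / c 0 o2) (-1); last first.
    by move=> _ _ _ /eqP; rewrite oppr_eq0 oner_eq0.
  apply/rowP => j; rewrite !mxE.
  have [-> | ji] := eqVneq j i.
    by rewrite (b0 i) // ci; field; rewrite ai bi c2.
  have [-> | ji'] := eqVneq j i'.
    by rewrite (a0 i') 1?eq_sym // ci'; field; rewrite ai bi c2.
  rewrite (a0 j) // (b0 j) //.
  have [[jE|jE|jE|jE] | j4] := ordP j.
  - by case: ab ji ji' => -[-> ->]; rewrite jE eqxx.
  - by case: ab ji ji' => -[-> ->]; rewrite jE eqxx.
  - by rewrite jE; field; rewrite ai bi c2.
  - by rewrite jE d3 c3; ring.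
  - by rewrite (dk j) // (c_top j) //; ring.
(* The coordinates along X_j X_3 force d to agree with d_3 w on the first four variables, w being
   taken for t'. *)
have d2 : d 0 o2 = - d 0 o3.
  have := dE o2 o3 isT; rewrite a2 a3 b2 b3 c3 mxE /=.
  rewrite !(mulr0, mul0r, addr0) [d 0 o3 * 2]mulrC -mulrDr => /eqP.
  by rewrite mulf_eq0 (negPf d3) mulf2_eq0 addr_eq0 => /eqP.
have d1 : d 0 o1 = 0.
  have := dE o1 o3 isT; rewrite a3 b3 c3 mxE /=.
  rewrite !(mulr0, mul0r, addr0) => /eqP.
  by rewrite mulf_eq0 (negPf d3) mulf2_eq0 => /eqP.
have d0 : d 0 o0 = (1 - t') * d 0 o3.
  have := dE o0 o3 isT; rewrite a3 b3 c3 mxE /=.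
  rewrite !(mulr0, mul0r, addr0) => /eqP.
  rewrite [d 0 o3 * (2 * _)]mulrC -mulrA -mulrDr mulrCA mulf2_eq0 mulf_eq0 (negPf d3).
  by rewrite addr_eq0 -mulNr opprB => /eqP.
move: e02 e12 e01; rewrite d0 d1 d2 mulr0 => e02 e12 /esym/eqP.
rewrite subr_eq0 expr2 mulrCA => /eqP /(mulfI c2) e01.
(* Eliminating c_2 and p gives t (t' + 1)^2 q^2 = t (t + 1)^2 p q = t' (t + 1)^2 q^2. *)
suff [p [q [q0 e1 e2 e3]]] : exists p q, [/\ q != 0,
    t * p = t' * q, (t + 1) * c 0 o2 = (t' + 1) * q & c 0 o2 ^+ 2 = p * q].
  have q2 : q ^+ 2 != 0 by rewrite sqrf_eq0.
  apply: (mulIf q2); rewrite -mulrA -exprMn -e2 exprMn e3.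
  by rewrite mulrCA [t * _]mulrA e1; ring.
case: ab => -[iE i'E].
  have [a1 b0'] : a 0 o1 = 0 /\ b 0 o0 = 0 by rewrite a0 ?iE // b0 ?i'E.
  move: e01 e02 e12 c2E; rewrite a1 b0' !(mulr0, addr0, add0r) => e01 e02 e12 c2E.
  have e1 : t * a 0 o0 = t' * b 0 o1.
    by apply: (mulIf c2); rewrite -e02 -mulrA -e12; ring.
  exists (a 0 o0), (b 0 o1); split=> //; first by rewrite -i'E.
  by rewrite e01 e1; ring.
have [a0' b1] : a 0 o0 = 0 /\ b 0 o1 = 0 by rewrite a0 ?iE // b0 ?i'E.
move: e01 e02 e12 c2E; rewrite a0' b1 !(mulr0, mul0r, addr0, add0r) => e01 e02 e12 c2E.
have e1 : b 0 o0 = t' * (t * a 0 o1).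
  by apply: (mulIf c2); rewrite -e02 -[RHS]mulrA -e12; ring.
(* When x and y are exchanged, c_2^2 = a_1 b_0 = t t' a_1^2 suggests this splitting into p q. *)
exists (t' * a 0 o1), (t * a 0 o1); split.
- by apply: contraNneq bi => ta1; rewrite i'E e1 ta1 mulr0.
- by ring.
- by rewrite e01 e1; ring.
- by rewrite c2E e1; ring.
Qed.

(** * From a graded isomorphism to equations between coordinates *)

Lemma family_sqr t (X := fun i => projA (family t) 'X_i) :
  [/\ X o0 ^+ 2 = 0, X o1 ^+ 2 = 0,
      X o2 ^+ 2 = 2 * (X o0 + X o1) * X o2
    & X o3 ^+ 2 = 2 * (projA (family t) (t - 1)%:MP * X o0 + X o2) * X o3].
Proof.
have sqrE i : X i ^+ 2 = (\sum_(j < n) family t i j *: X j) * X i.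
  rewrite projA_sqr mulr_suml big_mkcond; apply: eq_bigr => j _.
  case: leqP => [/family_TM -> | _]; last by rewrite scalerAl.
  by rewrite scale0r mul0r.
have sumE i : \sum_(j < n) family t i j *: X j =
    family t i o0 *: X o0 + family t i o1 *: X o1 + family t i o2 *: X o2.
  rewrite (bigD1 o0) //= (bigD1 o1) //= (bigD1 o2) //= big1 ?addr0 ?addrA //.
  move=> j; rewrite -!val_eqE mxE /= => /andP[/andP[j0 j1] j2].
  suff -> : match (i : nat), (j : nat) with
    | 2, 0 | 2, 1 | 3, 2 => 2 | 3, 0 => 2 * (t - 1) | _, _ => 0 end = 0.
    by rewrite scale0r.
  by case: i j j0 j1 j2 => [[|[|[|[|i]]]] ?] [[|[|[|j]]] ?].
have two := projA_nat (family t) 2.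
split; rewrite sqrE sumE !mxE /= ?scale0r ?addr0 ?add0r ?mul0r //.
  by rewrite !projA_scale two; ring.
by rewrite !projA_scale mpolyCM rmorphM two; ring.
Qed.

Lemma graded_iso_family t t' : graded_iso (family t) (family t') ->
  t * (t' + 1) ^+ 2 = t' * (t + 1) ^+ 2.
Proof.
case=> f [/bij_inj f_inj fgr].
have fM u v : f (u * v) = f u * f v by exact: rmorphM.
have fD u v : f (u + v) = f u + f v by exact: rmorphD.
have fZ s u : f (s *: u) = s *: f u by exact: linearZ.
have f0 : f 0 = 0 by exact: rmorph0.
pose V u := projA (family t) (linform u); pose W u := projA (family t') (linform u).
have VD u v : V (u + v) = V u + V v by rewrite /V linformD rmorphD.
have VZ s u : V (s *: u) = s *: V u by rewrite /V linformZ projAZ.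
have WD u v : W (u + v) = W u + W v by rewrite /W linformD rmorphD.
have WZ s u : W (s *: u) = s *: W u by rewrite /W linformZ projAZ.
have V0 : V 0 = 0 by rewrite -(scale0r 0) VZ scale0r.
have W0 : W 0 = 0 by rewrite -(scale0r 0) WZ scale0r.
(* Preserving degree 2 means sending linear forms to linear forms. *)
have fV u : exists v, f (V u) = W v.
  by apply: gradedP; rewrite -fgr; apply: graded_linform.
pose e i : 'rV[F]_n := delta_mx 0 i.
pose x := e o0; pose y := e o1; pose z := e o2 - x - y.
pose w := e o3 - (t - 1) *: x - e o2.
have [a fx] := fV x; have [b fy] := fV y; have [c fz] := fV z.
have [d fw] := fV w.
have [x2 y2 z2 w2] : [/\ V x * V x = 0, V y * V y = 0,
    V z * V z = 2 *: (V x * V y)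
  & V w * V w = (2 * (t + 1)) *: (V x * V y) + (2 * t) *: (V x * V z)
      + 2 *: (V y * V z)].
  pose X i := projA (family t) 'X_i.
  have [s0 s1 s2 s3] := family_sqr t; rewrite -!/(X _) in s0 s1 s2 s3.
  have Ve i : V (e i) = X i by rewrite /V linform_delta.
  have VB u v : V (u - v) = V u - V v by rewrite /V linformB rmorphB.
  have Vx : V x = X o0 by exact: Ve.
  have Vy : V y = X o1 by exact: Ve.
  have Vz : V z = X o2 - X o0 - X o1 by rewrite !VB Ve Vx Vy.
  have Vw : V w = X o3 - projA (family t) (t - 1)%:MP * X o0 - X o2.
    by rewrite !VB VZ !Ve.
  have two := projA_nat (family t) 2.
  rewrite Vx Vy Vz Vw !projA_scale !mpolyCM !rmorphM two
    !mpolyCD !rmorphD mpolyCN mpolyC1 rmorphN rmorph1.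
  split.
  - by rewrite -expr2.
  - by rewrite -expr2.
  - transitivity (X o2 ^+ 2 - 2 * (X o0 + X o1) * X o2 + X o0 ^+ 2 + X o1 ^+ 2
      + 2 * (X o0 * X o1)); first by ring.
    by rewrite s0 s1 s2; ring.
  - move: s3; rewrite mpolyCD rmorphD mpolyCN mpolyC1 rmorphN rmorph1.
    set u := (X in X - 1) => s3.
    transitivity (X o3 ^+ 2 - 2 * ((u - 1) * X o0 + X o2) * X o3
      + (u - 1) ^+ 2 * X o0 ^+ 2 + 2 * (u - 1) * X o0 * X o2 + X o2 ^+ 2).
      by ring.
    rewrite s3 s2 s0; transitivity (2 * u * (X o0 * X o2 - X o0 ^+ 2)
      + 2 * (X o1 * X o2 - X o1 ^+ 2)); last by ring.
    by rewrite s0 s1; ring.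
apply: (@family_rigid t t' a b c d).
  move=> l m p q /(congr1 W); rewrite W0 !WD !WZ -fx -fy -fz -fw.
  rewrite -!fZ -!fD -f0 => /f_inj.
  rewrite -!VZ -!VD => e0.
  have {e0} : V (l *: x + m *: y + p *: z + q *: w) = V 0.
    by rewrite e0 V0.
  (* The system is triangular: X_3 occurs only in w, and without w, X_2 occurs only in z. *)
  move/projA_linform_inj/rowP => h.
  have := h o3; have := h o2; have := h o1; have := h o0; rewrite !mxE /=.
  rewrite !(mulr0, mulr1, subr0, sub0r, add0r, addr0) => h0 h1 h2 q0.
  move: h0 h1 h2; rewrite q0 !mul0r !addr0 => h0 h1 p0.
  by move: h0 h1; rewrite p0 !mul0r !addr0 => -> ->.
move=> j k jk.
have tr u v r : W u * W v = projA (family t') r ->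
    2 * (u 0 j * v 0 k + u 0 k * v 0 j + u 0 k * v 0 k * family t' k j) =
    coord (family t') j k r.
  by rewrite -rmorphM => /(coord_projA jk); rewrite coord_linformM.
have WM u v : W u * W v = projA (family t') (linform u * linform v) by rewrite rmorphM.
split; apply: (mulfI two_neq0).
- rewrite (tr a a 0) ?rmorph0; last by rewrite -fx -fM x2 f0.
  by rewrite -(scale0r 0) coordZ mul0r mulr0.
- rewrite (tr b b 0) ?rmorph0; last by rewrite -fy -fM y2 f0.
  by rewrite -(scale0r 0) coordZ mul0r mulr0.
- rewrite (tr c c (2 *: (linform a * linform b))).
    by rewrite coordZ coord_linformM.
  by rewrite projAZ -WM -fx -fy -fz -!fM z2 fZ.
- rewrite (tr d d ((2 * (t + 1)) *: (linform a * linform b)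
    + (2 * t) *: (linform a * linform c) + 2 *: (linform b * linform c))).
    by rewrite !coordD !coordZ !coord_linformM; ring.
  by rewrite !projAD !projAZ -!WM -fx -fy -fz -fw -!fM w2 !fD !fZ.
Qed.
End Family.

(** * Counting the classes *)

Theorem theorem3p2 (n : nat) (F : fieldType) (hn : (4 <= n)%N)
    (hF : 2%N \notin [pchar F]) :
  finite_set (iso_classes F n) <-> finite_set [set: F]%classic.
Proof.
have two_neq0 : 2 != 0 :> F by move: hF; rewrite inE.
pose C (T : 'M[F]_n) := [set S | TM S /\ graded_iso T S]%classic.
split=> [fin | finF].
  pose cl t := C (family n t).
  have clE t t' : cl t = cl t' -> t' = t \/ t' = t^-1.
    move=> tt'; have : C (family n t) (family n t').
      by rewrite -/(cl t) tt'; split; [exact: family_TM | exact: graded_iso_refl].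
    case=> _ /(graded_iso_family hn two_neq0) e.
    have : (t' - t) * (t * t' - 1) = 0.
      transitivity (t * (t' + 1) ^+ 2 - t' * (t + 1) ^+ 2); first by ring.
      by rewrite e subrr.
    move/eqP; rewrite mulf_eq0 !subr_eq0 => /orP[/eqP | /eqP tt]; first by left.
    right; rewrite -[t^-1]mulr1 -tt mulKf //.
    by apply: contraTneq (oner_neq0 F) => t0; rewrite -tt t0 mul0r eqxx.
  (* The field is covered by the fibres of [cl] over the finitely many classes, each fibre having at
     most two elements. *)
  apply: (@sub_finite_set _ _
      (\bigcup_(D in iso_classes F n) [set t | cl t = D])%classic).
    by move=> t _; exists (cl t) => //; exists (family n t) => //; exact: family_TM.
  apply: bigcup_finite => // D _.
  have [[t <-] | noD] := pselect (exists t, cl t = D).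
    apply: sub_finite_set (finite_set2 t t^-1) => t' /= /esym /clE [] ->;
      [by left | by right].
  rewrite (_ : [set t | cl t = D]%classic = set0) //.
  by apply/seteqP; split=> // t /= tD; apply: noD; exists t.
have -> : iso_classes F n = (C @` @TM F n)%classic.
  by apply/seteqP; split=> D [T ? e]; exists T.
apply: finite_image; have /finite_seqP[s sE] := finF.
(* With s listing the elements of F, every matrix is the image of a point of a finite type. *)
pose mx (g : {ffun 'I_n * 'I_n -> seq_sub s}) := \matrix_(i, j) ssval (g (i, j)).
apply: (@sub_finite_set _ _ (mx @` [set: _])%classic); last first.
  by apply: finite_image; apply: finite_finset.
move=> T _; have inS u : u \in s by have : [set: F]%classic u by []; rewrite sE.
exists [ffun ij => SeqSub (inS (T ij.1 ij.2))] => //.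
by apply/matrixP => i j; rewrite mxE ffunE.
Qed.
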